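(* Let $\Phi=(A;\{E_i\}_{i=0}^d;A^*;\{E^*_i\}_{i=0}^d)$ be a tridiagonal system on $V$ with $d\ge1$, let $R$ be the $\Phi$-raising map, let $\mathcal R$ be the $\Phi$-split raising map, let $\{F_i\}_{i=0}^d$ be the projections for the $\Phi$-split decomposition, and put $T=\sum_{\ell=0}^dF_\ell E^*_\ell$. For $0\le j\le d-1$ the diagram with top map $R:E^*_jV\to E^*_{j+1}V$, bottom map $\mathcal R:F_jV\to F_{j+1}V$, and vertical maps $T:E^*_jV\to F_jV$ and $T:E^*_{j+1}V\to F_{j+1}V$ commutes; that is, $TRv=\mathcal RTv$ for all $v\in E^*_jV$.
   Context: Let $\mathbb F$ be a field and $V$ a nonzero finite-dimensional vector space over $\mathbb F$; $\mathrm{End}(V)$ is the algebra of $\mathbb F$-linear maps $V\to V$, with identity $I$. A tridiagonal pair on $V$ is an ordered pair $A,A^*\in\mathrm{End}(V)$ such that: (1) each of $A,A^*$ is diagonalizable; (2) there is an ordering $\{V_i\}_{i=0}^d$ of the eigenspaces of $A$ with $A^*V_i\subseteq V_{i-1}+V_i+V_{i+1}$ $(0\le i\le d)$, where $V_{-1}=V_{d+1}=0$; (3) there is an ordering $\{V^*_i\}_{i=0}^\delta$ of the eigenspaces of $A^*$ with $AV^*_i\subseteq V^*_{i-1}+V^*_i+V^*_{i+1}$ $(0\le i\le\delta)$, where $V^*_{-1}=V^*_{\delta+1}=0$; (4) there is no subspace $W\subseteq V$ with $W\ne0$, $W\ne V$, $AW\subseteq W$, $A^*W\subseteq W$. It is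 known that $d=\delta$. Orderings as in (2), (3) are called standard. For a diagonalizable map, the primitive idempotent attached to an eigenspace is the projection onto that eigenspace that vanishes on the other eigenspaces; an ordering of primitive idempotents is standard if the corresponding ordering of eigenspaces is. A tridiagonal system on $V$ is a sequence $\Phi=(A;\{E_i\}_{i=0}^d;A^*;\{E^*_i\}_{i=0}^d)$ where $A,A^*$ is a tridiagonal pair on $V$, $\{E_i\}$ is a standard ordering of the primitive idempotents of $A$, and $\{E^*_i\}$ is a standard ordering of the primitive idempotents of $A^*$. Let $\theta_i$ (resp. $\theta^*_i$) be the eigenvalue of $A$ (resp. $A^*$) for $E_i$ (resp. $E^*_i$); $\{\theta_i\}_{i=0}^d$ and $\{\theta^*_i\}_{i=0}^d$ are the eigenvalue and dual eigenvalue sequences. Throughout $d\ge1$. Define $R=\sum_{i=0}^{d-1}E^*_{i+1}AE^*_i$, $F=\sum_{i=0}^dE^*_iAE^*_i$, $L=\sum_{i=1}^dE^*_{i-1}AE^*_i$ (the $\Phi$-raising, $\Phi$-flat, $\Phi$-lowering maps). $\Phi$-split decomposition: $U_i=(E^*_0V+\cdots+E^*_iV)\cap(E_iV+\cdots+E_dV)$ for $0\le i\le d$; it is known that $V=\sum_{i=0}^dU_i$ is a direct sum. $F_i\in\mathrm{End}(V)$ is the projection onto $U_i$ with $F_iU_j=0$ for $j\ne i$ (so $F_iV=U_i$). Define $\mathcal R=A-\sum_{i=0}^d\theta_iF_i$ (the $\Phi$-split raising map) and $\mathcal L=A^*-\sum_{i=0}^d\theta^*_iF_i$ (the $\Phi$-split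 lowering map). It is known that $\mathcal RF_iV\subseteq F_{i+1}V$, $\mathcal LF_iV\subseteq F_{i-1}V$ (with $F_{-1}V=F_{d+1}V=0$), and that $\sum_{\ell=0}^dF_\ell E^*_\ell$ is a bijection $V\to V$ sending $E^*_iV$ onto $F_iV$ for each $i$. *)

(* Defs.v *)
From mathcomp Require Import all_boot all_algebra.
Set Implicit Arguments.
Unset Strict Implicit.
Unset Printing Implicit Defensive.
Import GRing.Theory.
Local Open Scope ring_scope.

Section TridiagonalPairs.
Variables (K : fieldType) (V : vectType K).
Implicit Types (A As B : 'End(V)) (d : nat).

Definition diagonalizable_end A : Prop :=
  exists2 X : seq V, basis_of fullv X & {in X, forall v, exists a, A v = a *: v}.

Definition is_eigenspace A (W : {vspace V}) : Prop :=
  exists2 a : K, passmx.leigenvalue A a & W = passmx.leigenspace A a.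

Definition eigenspace_ordering A d (W : 'I_d.+1 -> {vspace V}) : Prop :=
  injective W /\ forall U, is_eigenspace A U <-> exists i, W i = U.

(* The sum ranges over the j in {i - 1, i, i + 1} with 0 <= j <= d, in
   accordance with the convention W_{-1} = W_{d+1} = 0. *)
Definition standard_ordering A B d (W : 'I_d.+1 -> {vspace V}) : Prop :=
  eigenspace_ordering A W /\
  forall i, (B @: W i <= \sum_(j < d.+1 | (i <= j.+1)%N && (j <= i.+1)%N) W j)%VS.

Definition irreducible_pair A As : Prop :=
  ~ exists W : {vspace V},
      [/\ W <> 0%VS, W <> fullv, (A @: W <= W)%VS & (As @: W <= W)%VS].

Definition tridiagonal_pair A As : Prop :=
  [/\ diagonalizable_end A /\ diagonalizable_end As,
      exists d (W : 'I_d.+1 -> {vspace V}), standard_ordering A As W,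
      exists delta (W : 'I_delta.+1 -> {vspace V}), standard_ordering As A W
    & irreducible_pair A As].

Definition primitive_idempotent A (W : {vspace V}) (E : 'End(V)) : Prop :=
  [/\ limg E = W, {in W, forall v, E v = v}
    & forall U, is_eigenspace A U -> U <> W -> {in U, forall v, E v = 0}].

Definition standard_idempotents A B d (E : 'I_d.+1 -> 'End(V)) : Prop :=
  exists2 W : 'I_d.+1 -> {vspace V},
    standard_ordering A B W & forall i, primitive_idempotent A (W i) (E i).

Definition tridiagonal_system A d (E : 'I_d.+1 -> 'End(V))
    As (Es : 'I_d.+1 -> 'End(V)) : Prop :=
  [/\ tridiagonal_pair A As, standard_idempotents A As E
    & standard_idempotents As A Es].

(* In a tridiagonal system each E_i V is a nonzero eigenspace, so this
   determines [theta]. *)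
Definition eigenvalue_sequence A d (E : 'I_d.+1 -> 'End(V))
    (theta : 'I_d.+1 -> K) : Prop :=
  forall i, limg (E i) = passmx.leigenspace A (theta i).

(* For i < d, [widen_ord (leqnSn d) i] and [lift ord0 i] are the indices
   i and i + 1 in 'I_d.+1. *)
Definition raising_map A d (Es : 'I_d.+1 -> 'End(V)) : 'End(V) :=
  \sum_(i < d) (Es (lift ord0 i) \o A \o Es (widen_ord (leqnSn d) i))%VF.

Definition split_space d (E Es : 'I_d.+1 -> 'End(V)) (i : 'I_d.+1) :
    {vspace V} :=
  ((\sum_(k < d.+1 | (k <= i)%N) limg (Es k)) :&:
   (\sum_(k < d.+1 | (i <= k)%N) limg (E k)))%VS.

(* [sumv_pi] is total; it is the intended projection when the split spaces form
   a direct sum (see [split_projE]), which is a known property of tridiagonal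
   systems. *)
Definition split_proj d (E Es : 'I_d.+1 -> 'End(V)) (i : 'I_d.+1) : 'End(V) :=
  sumv_pi (\sum_(j < d.+1) split_space E Es j)%VS i.

Lemma split_projE d (E Es : 'I_d.+1 -> 'End(V)) (i j : 'I_d.+1) (u : V) :
  directv (\sum_(j < d.+1) split_space E Es j) -> u \in split_space E Es j ->
  split_proj E Es i u = if i == j then u else 0.
Proof.
move=> dir Uu.
pose w k : V := if k == j then u else 0.
have Uw k : true -> w k \in split_space E Es k.
  by rewrite /w; case: eqP => [->|]; rewrite ?mem0v.
have Up k : true -> split_proj E Es k u \in split_space E Es k.
  by move=> _; apply: memv_sum_pi.
have sum_w : \sum_k w k = u.
  by rewrite (bigD1 j) //= /w eqxx big1 ?addr0 // => k /negPf->.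
have sum_p : \sum_k split_proj E Es k u = u.
  by apply: sumv_pi_sum; rewrite // -sum_w; apply: memv_sumr => k; apply: Uw.
have /directv_sum_unique/(_ _ _ Up Uw) := dir.
by rewrite sum_w sum_p eqxx => /esym/forall_inP/(_ i isT)/eqP.
Qed.

Definition split_raising_map A d (E Es : 'I_d.+1 -> 'End(V))
    (theta : 'I_d.+1 -> K) : 'End(V) :=
  A - \sum_(i < d.+1) theta i *: split_proj E Es i.

Definition transition_map d (E Es : 'I_d.+1 -> 'End(V)) : 'End(V) :=
  \sum_(l < d.+1) (split_proj E Es l \o Es l)%VF.

End TridiagonalPairs.

(* Main.v *)
(* Put X_i = E*_0 V + ... + E*_{i-1} V and Y_j = E_j V + ... + E_d V.  Since
   A - theta_j maps X_i :&: Y_j into X_{i+1} :&: Y_{j+1} and A* - theta*_i maps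
   X_{i+1} :&: Y_j into X_i :&: Y_{j-1}, each diagonal sum of the spaces
   X_{i+1} :&: Y_{i+r} is invariant under A and A*.  By irreducibility it is V
   for r = 0 (it contains E*_0 V) and 0 for r = 1 (it lies in Y_1 <> V).  Hence
   V is the direct sum of the U_i = X_{i+1} :&: Y_i and
   X_{i+1} = U_0 + ... + U_i.  For v in E*_j V both sides of the claim are then
   F_{j+1} A v, because v - F_j v and A v - E*_{j+1} A v lie in
   U_0 + ... + U_{j-1} and U_0 + ... + U_j respectively, and because
   (A - theta_j) F_j v lies in U_{j+1}. *)
Require Import Defs.
From mathcomp Require Import all_boot all_algebra.
Set Implicit Arguments.
Unset Strict Implicit.
Unset Printing Implicit Defensive.
Import GRing.Theory.
Local Open Scope ring_scope.

(** * Partial sums of eigenspaces under the two maps *)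

Section PartialSums.
Variables (K : fieldType) (V : vectType K) (d : nat).
Implicit Types (A B : 'End(V)) (W : 'I_d.+1 -> {vspace V}) (P Q : pred 'I_d.+1).

Lemma memv_leigenspace A a v :
  (v \in passmx.leigenspace A a) = (A v == a *: v).
Proof.
by rewrite memv_ker add_lfunE opp_lfunE scale_lfunE id_lfunE subr_eq0.
Qed.

Lemma memv_sum_sup W P i v :
  P i -> v \in W i -> v \in (\sum_(k | P k) W k)%VS.
Proof. by move=> Pi; apply/subvP/(sumv_sup i). Qed.

Lemma sumv_widen W P Q :
  {subset P <= Q} -> (\sum_(k | P k) W k <= \sum_(k | Q k) W k)%VS.
Proof.
by move=> sPQ; apply/subv_sumP => k /sPQ Qk; apply: sumv_sup (subvv _).
Qed.

(** On each [W k] the map [A - theta i] is the scalar [theta k - theta i], so it kills [W i] and the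
    index [i] may be dropped from [P]. *)
Lemma sumv_eigen_step A W theta P Q i v :
    (forall k, W k = passmx.leigenspace A (theta k)) ->
    (forall k, P k -> k != i -> Q k) ->
    v \in (\sum_(k | P k) W k)%VS ->
  A v - theta i *: v \in (\sum_(k | Q k) W k)%VS.
Proof.
move=> defW sPQ /memv_sumP[w Ww ->].
rewrite linear_sum scaler_sumr -sumrB /=; apply: memv_suml => k Pk.
have := Ww k Pk; rewrite {1}defW memv_leigenspace => /eqP->.
have [->|ki] := eqVneq k i; first by rewrite subrr mem0v.
rewrite -scalerBl memvZ //.
exact: memv_sum_sup (sPQ k Pk ki) (Ww k Pk).
Qed.

Lemma sumv_tridiagonal_step B W P Q (v : V) :
    (forall k, (B @: W k <=
       \sum_(l < d.+1 | (k <= l.+1)%N && (l <= k.+1)%N) W l)%VS) ->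
    (forall k l : 'I_d.+1, P k -> (k <= l.+1)%N -> (l <= k.+1)%N -> Q l) ->
    v \in (\sum_(k | P k) W k)%VS ->
  B v \in (\sum_(k | Q k) W k)%VS.
Proof.
move=> tri sPQ /memv_sumP[w Ww ->].
rewrite linear_sum; apply: memv_suml => k Pk.
have /(subvP (tri k)) := memv_img B (Ww k Pk).
by apply/subvP/sumv_widen => l /andP[kl lk]; apply: sPQ Pk kl lk.
Qed.

End PartialSums.

(** * Primitive idempotents in a standard ordering *)

Section Idempotents.
Variables (K : fieldType) (V : vectType K) (d : nat).
Variables (A B : 'End(V)) (E : 'I_d.+1 -> 'End(V)).
Hypothesis diagA : diagonalizable_end A.
Hypothesis stdE : standard_idempotents A B E.

Lemma idempotents_eigenvalues : exists theta, eigenvalue_sequence A E theta.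
Proof.
have [W [[_ eigW] _] idE] := stdE.
have eigE i : exists a, limg (E i) = passmx.leigenspace A a.
  have [-> _ _] := idE i.
  by have [_ /(_ (ex_intro _ i erefl))[a _ ->]] := eigW (W i); exists a.
by have [theta thetaP] := fin_all_exists eigE; exists theta.
Qed.

Lemma idempotents_tridiagonal i :
  (B @: limg (E i) <=
     \sum_(j < d.+1 | (i <= j.+1)%N && (j <= i.+1)%N) limg (E j))%VS.
Proof.
have [W [_ tri] idE] := stdE.
have defW k : limg (E k) = W k by have [] := idE k.
by rewrite defW (eq_bigr W) // => k _; apply: defW.
Qed.

Lemma idempotents_neq0 i : limg (E i) != 0%VS.
Proof.
have [W [[_ eigW] _] idE] := stdE; have [-> _ _] := idE i.
by have [_ /(_ (ex_intro _ i erefl))[a nz ->]] := eigW (W i).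
Qed.

Lemma idempotentsE i j v : v \in limg (E j) -> E i v = if i == j then v else 0.
Proof.
have [W [[injW eigW] _] idE] := stdE; have [-> _ _] := idE j => Wv.
have [_ idW zeroW] := idE i; have [ij|neq_ij] := eqVneq i j.
  by apply: idW; rewrite ij.
apply: (zeroW (W j)) => //; first by apply/eigW; exists j.
by move=> /injW ji; rewrite ji eqxx in neq_ij.
Qed.

(** Each vector of an eigenbasis is nonzero, hence spans a line in a genuine eigenspace, and the
    ordering lists every eigenspace. *)
Lemma idempotents_full : (\sum_i limg (E i) = fullv)%VS.
Proof.
have [W [[_ eigW] _] idE] := stdE; have [X basX eigX] := diagA.
apply/eqP; rewrite eqEsubv subvf /= -{1}(span_basis basX).
apply/span_subvP => x Xx; have [a Ax] := eigX x Xx.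
have eigx : x \in passmx.leigenspace A a by rewrite memv_leigenspace Ax.
have x_neq0 : x != 0 by exact: basis_not0 basX Xx.
have [|i defWi] := (eigW (passmx.leigenspace A a)).1.
  exists a => //; apply: contraNneq x_neq0 => W0.
  by rewrite -memv0 -W0.
have [defEi _ _] := idE i; apply: (@memv_sum_sup _ _ _ _ _ i) => //.
by rewrite defEi defWi.
Qed.

Lemma idempotents_sum_sub P (i : 'I_d.+1) v :
    v \in (\sum_(k | P k) limg (E k))%VS ->
  v - E i v \in (\sum_(k | P k && (k != i)) limg (E k))%VS.
Proof.
move=> /memv_sumP[w Ew ->]; rewrite linear_sum -sumrB /=.
apply: memv_suml => k Pk; rewrite (idempotentsE i (Ew k Pk)).
have [->|ki] := eqVneq i k; first by rewrite subrr mem0v.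
rewrite subr0; apply: memv_sum_sup (Ew k Pk).
by rewrite Pk eq_sym.
Qed.

End Idempotents.

(** * Flags of the two eigenspace orderings and the split decomposition *)

Section SplitDecomposition.
Variables (K : fieldType) (V : vectType K) (d : nat).
Variables (A As : 'End(V)) (E Es : 'I_d.+1 -> 'End(V)) (theta : 'I_d.+1 -> K).
Hypothesis Phi_TD : tridiagonal_system A E As Es.
Hypothesis theta_eigen : eigenvalue_sequence A E theta.

Let diagA : diagonalizable_end A. Proof. by have [[[]]] := Phi_TD. Qed.
Let diagAs : diagonalizable_end As. Proof. by have [[[]]] := Phi_TD. Qed.
Let irr : irreducible_pair A As. Proof. by have [[]] := Phi_TD. Qed.
Let stdE : standard_idempotents A As E. Proof. by have [] := Phi_TD. Qed.
Let stdEs : standard_idempotents As A Es. Proof. by have [] := Phi_TD. Qed.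

(** The strict bound gives [lower_flag 0 = 0]. Both flags are indexed by [nat], so that shifts past
    [d] make sense. *)
Definition lower_flag (i : nat) : {vspace V} :=
  (\sum_(k < d.+1 | (k < i)%N) limg (Es k))%VS.

Definition upper_flag (j : nat) : {vspace V} :=
  (\sum_(k < d.+1 | (j <= k)%N) limg (E k))%VS.

Lemma split_spaceE i :
  split_space E Es i = (lower_flag i.+1 :&: upper_flag i)%VS.
Proof. by []. Qed.

Lemma lower_flagS i j : (i <= j)%N -> (lower_flag i <= lower_flag j)%VS.
Proof. by move=> ij; apply: sumv_widen => k /leq_trans; apply. Qed.

Lemma upper_flagS i j : (i <= j)%N -> (upper_flag j <= upper_flag i)%VS.
Proof. by move=> ij; apply: sumv_widen => k; apply: leq_trans. Qed.

Lemma A_lower_flag i v : v \in lower_flag i -> A v \in lower_flag i.+1.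
Proof.
apply: sumv_tridiagonal_step (idempotents_tridiagonal stdEs) _ => k l ki _ lk.
exact: leq_ltn_trans lk _.
Qed.

(** The truncated predecessor is harmless at [j = 0], where the flag is all of [V]. *)
Lemma As_upper_flag j v : v \in upper_flag j -> As v \in upper_flag j.-1.
Proof.
apply: sumv_tridiagonal_step (idempotents_tridiagonal stdE) _ => k l jk kl _.
by rewrite -subn1 leq_subLR add1n (leq_trans jk).
Qed.

(* For d < j the index [inord j] is junk, but then upper_flag j = 0. *)
Lemma A_upper_flag j v :
  v \in upper_flag j -> A v - theta (inord j) *: v \in upper_flag j.+1.
Proof.
apply: sumv_eigen_step theta_eigen _ => k jk.
apply: contraNT; rewrite -leqNgt => kj; apply/eqP/val_inj => /=.
have defj : j = k by apply/eqP; rewrite eqn_leq jk.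
by rewrite defj inordK.
Qed.

(** The scalar is the dual eigenvalue of index [i]; only its existence matters below. *)
Lemma As_lower_flag (i : 'I_d.+1) :
  exists a, forall v, v \in lower_flag i.+1 -> As v - a *: v \in lower_flag i.
Proof.
have [thetas eigAs] := idempotents_eigenvalues stdEs.
exists (thetas i) => v; apply: sumv_eigen_step eigAs _ => k ki neq_ki.
by rewrite ltn_neqAle neq_ki.
Qed.

Lemma upper_flag_eq0 j : (d < j)%N -> upper_flag j = 0%VS.
Proof.
move=> dj; rewrite /upper_flag big1 // => k jk.
by have := leq_trans dj jk; rewrite ltnNge -ltnS ltn_ord.
Qed.

(** Offset [r = 0] gives the sum of the split spaces; [r = 1] collects the intersections that must
    vanish for this sum to be direct. *)
Definition diagonal_sum (r : nat) : {vspace V} :=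
  (\sum_(i < d.+1) (lower_flag i.+1 :&: upper_flag (i + r)))%VS.

(** Write [A v] as [(A v - a *: v) + a *: v]: the first term moves to the next summand, the second
    stays. *)
Lemma diagonal_sum_invariant_A r : (A @: diagonal_sum r <= diagonal_sum r)%VS.
Proof.
rewrite limg_sum; apply/subv_sumP => i _.
apply/subvP => _ /memv_imgP[v Zv ->].
have := Zv; rewrite memv_cap => /andP[/A_lower_flag Xv Yv].
set a := theta (inord (i + r)); rewrite -(subrK (a *: v) (A v)).
apply: memvD; last first.
  by apply/memvZ; apply: memv_sum_sup Zv.
have XY : A v - a *: v \in (lower_flag i.+2 :&: upper_flag (i.+1 + r))%VS.
  rewrite memv_cap addSn A_upper_flag // andbT memvB // memvZ //.
  by move: Zv; rewrite memv_cap => /andP[/(subvP (lower_flagS (leqnSn _)))].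
(* For [i = d] there is no next summand, but the upper flag beyond [d] is zero. *)
case: (ltnP i d) => [lt_id | le_di]; last first.
  move: XY; rewrite (@upper_flag_eq0 (i.+1 + r)) ?capv0 ?memv0; last first.
    exact: leq_trans (leq_addr _ _).
  by move/eqP->; apply: mem0v.
have lti : (i.+1 < d.+1)%N by [].
exact: (@memv_sum_sup _ _ _ _ _ (Ordinal lti)).
Qed.

Lemma diagonal_sum_invariant_As r : (As @: diagonal_sum r <= diagonal_sum r)%VS.
Proof.
rewrite limg_sum; apply/subv_sumP => i _.
apply/subvP => _ /memv_imgP[v Zv ->].
have := Zv; rewrite memv_cap => /andP[Xv Yv].
have [a /(_ v Xv) XAs] := As_lower_flag i; rewrite -(subrK (a *: v) (As v)).
apply: memvD; last first.
  by apply/memvZ; apply: memv_sum_sup Zv.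
have YAs : As v - a *: v \in upper_flag (i + r).-1.
  rewrite memvB ?As_upper_flag // memvZ //.
  by apply: (subvP (upper_flagS _)) Yv; apply: leq_pred.
(* For [i = 0] the difference lies in [lower_flag 0 = 0]; otherwise it lies in the preceding
   summand. *)
case: i => -[|i] lti /= in Zv Xv Yv XAs YAs *.
  by move: XAs; rewrite /lower_flag big_pred0 // memv0 => /eqP->; apply: mem0v.
apply: (@memv_sum_sup _ _ _ _ _ (Ordinal (ltnW lti))) => //.
by rewrite memv_cap XAs.
Qed.

Lemma diagonal_sum_trivial r : diagonal_sum r = 0%VS \/ diagonal_sum r = fullv.
Proof.
have [->|nz] := eqVneq (diagonal_sum r) 0%VS; first by left.
have [->|nf] := eqVneq (diagonal_sum r) fullv; first by right.
case: irr; exists (diagonal_sum r); split; try exact/eqP.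
  exact: diagonal_sum_invariant_A.
exact: diagonal_sum_invariant_As.
Qed.

(** The nonzero map [E ord0] vanishes on all of [upper_flag 1]. *)
Lemma upper_flag1_proper : upper_flag 1 <> fullv.
Proof.
move=> Yfull; have /negP[] := idempotents_neq0 stdE ord0.
rewrite -subv0; apply/subvP => _ /memv_imgP[v _ ->].
have: v \in upper_flag 1 by rewrite Yfull memvf.
case/memv_sumP => w Ew ->; rewrite linear_sum /= big1 ?mem0v // => k k_gt0.
rewrite (idempotentsE stdE ord0 (Ew k k_gt0)) ifN //.
by rewrite eq_sym -lt0n.
Qed.

(** For [0 < m <= d.+1] the intersection is the summand of index [m.-1] in [diagonal_sum 1], which
    cannot be [V] because it lies in [upper_flag 1]. *)
Lemma flag_disjoint m : (lower_flag m :&: upper_flag m = 0)%VS.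
Proof.
case: m => [|m]; first by rewrite /lower_flag big_pred0 ?cap0v.
have [le_md|lt_dm] := leqP m d; last by rewrite upper_flag_eq0 ?capv0 // ltnW.
have [Z0|Zfull] := diagonal_sum_trivial 1.
  apply/eqP; rewrite -subv0 -Z0 -[X in upper_flag X]addn1.
  exact: (sumv_sup (Ordinal (le_md : m < d.+1)%N)).
case: upper_flag1_proper; apply/eqP; rewrite eqEsubv subvf -Zfull.
apply/subv_sumP => k _; apply: subv_trans (capvSr _ _) _.
by rewrite addn1 upper_flagS.
Qed.

Lemma split_space_full : (\sum_i split_space E Es i = fullv)%VS.
Proof.
have [Z0|] := diagonal_sum_trivial 0; last first.
  move=> <-; apply: eq_bigr => i _.
  by rewrite split_spaceE -[X in upper_flag X]addn0.
(* The summand of index 0 contains the nonzero space [limg (Es ord0)], since [upper_flag 0] is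
   [V]. *)
case/negP: (idempotents_neq0 stdEs ord0); rewrite -subv0 -Z0.
apply: (sumv_sup ord0) => //; rewrite subv_cap /upper_flag.
rewrite (idempotents_full diagA stdE) subvf andbT.
exact: sumv_sup (subvv _).
Qed.

(** In a vanishing sum, the nonzero term of largest index [m] is minus the sum of earlier terms, so
    it lies in both flags at [m]. *)
Lemma split_space_direct : directv (\sum_i split_space E Es i).
Proof.
apply/directv_sum_independent => u Uu sum_u0 i _.
apply/eqP; apply: contraT => nz.
have [m u_m max_m] := @arg_maxnP _ i (fun k => u k != 0) val nz.
case/negP: u_m; rewrite -memv0 -(flag_disjoint m) memv_cap.
have := Uu m isT; rewrite split_spaceE memv_cap => /andP[_ ->]; rewrite andbT.
move/eqP: sum_u0; rewrite (bigD1 m) //= addr_eq0 => /eqP->; rewrite memvN.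
apply: memv_suml => k neq_km.
have [->|/max_m le_km] := eqVneq (u k) 0; first exact: mem0v.
have := Uu k isT; rewrite split_spaceE memv_cap => /andP[+ _].
by apply/subvP/lower_flagS; rewrite ltn_neqAle neq_km.
Qed.

(** * Components along the split decomposition *)

Lemma split_proj_mem i v : split_proj E Es i v \in split_space E Es i.
Proof. exact: memv_sum_pi. Qed.

Lemma split_proj_sum v : \sum_i split_proj E Es i v = v.
Proof. by apply: sumv_pi_sum; rewrite // split_space_full memvf. Qed.

Lemma split_proj_lower_flag (i : 'I_d.+1) m v :
  v \in lower_flag m -> (m <= i)%N -> split_proj E Es i v = 0.
Proof.
move=> Xv le_mi; pose P := [pred k : 'I_d.+1 | m <= k]%N.
have := split_proj_sum v; rewrite (bigID P) /= => /(canRL (addrK _)) sumP.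
(* The components of index at least [m] add up to a vector of [upper_flag m]; as [v] minus the other
   components, it is also in [lower_flag m]. *)
have sum0 : \sum_(k | P k) split_proj E Es k v = 0.
  apply/eqP; rewrite -memv0 -(flag_disjoint m) memv_cap; apply/andP; split.
    rewrite sumP memvB //; apply: memv_suml => k; rewrite -ltnNge => lt_km.
    have := split_proj_mem k v; rewrite split_spaceE memv_cap => /andP[+ _].
    by apply/subvP/lower_flagS.
  apply: memv_suml => k le_mk.
  have := split_proj_mem k v; rewrite split_spaceE memv_cap => /andP[_].
  by apply/subvP/upper_flagS.
(* Projecting this zero sum isolates the component of index [i]. *)
have := congr1 (split_proj E Es i) sum0.
rewrite linear0 linear_sum (bigD1 i) //= big1 ?addr0.
  by rewrite (split_projE _ split_space_direct (split_proj_mem i v)) eqxx.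
move=> k /andP[_ neq_ki].
rewrite (split_projE _ split_space_direct (split_proj_mem k v)).
by rewrite eq_sym (negPf neq_ki).
Qed.

Lemma sub_split_proj_lower_flag (i : 'I_d.+1) v :
  v \in lower_flag i.+1 -> v - split_proj E Es i v \in lower_flag i.
Proof.
move=> Xv; rewrite -{1}(split_proj_sum v) (bigD1 i) //= addrC addrK.
apply: memv_suml => k neq_ki; have [lt_ki|lt_ik|eq_ki] := ltngtP k i.
- have := split_proj_mem k v; rewrite split_spaceE memv_cap => /andP[+ _].
  by apply/subvP/lower_flagS.
- by rewrite (split_proj_lower_flag Xv) ?mem0v.
- by rewrite (val_inj eq_ki) eqxx in neq_ki.
Qed.

(** * Action of the raising maps and of [T] on single components *)

Lemma split_space_raise (i k : 'I_d.+1) u :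
    k = i.+1 :> nat -> u \in split_space E Es i ->
  A u - theta i *: u \in split_space E Es k.
Proof.
move=> def_k; rewrite !split_spaceE !memv_cap def_k => /andP[Xu Yu].
have := A_upper_flag Yu; rewrite inord_val => ->; rewrite andbT.
rewrite memvB ?A_lower_flag // memvZ //.
exact: (subvP (lower_flagS (leqnSn _))) Xu.
Qed.

Lemma split_raising_mapE (i : 'I_d.+1) u :
    u \in split_space E Es i ->
  split_raising_map A E Es theta u = A u - theta i *: u.
Proof.
move=> Uu; rewrite /split_raising_map add_lfunE opp_lfunE sum_lfunE.
rewrite (bigD1 i) //= big1 ?addr0 => [|k neq_ki]; rewrite scale_lfunE.
  by rewrite (split_projE _ split_space_direct Uu) eqxx.
by rewrite (split_projE _ split_space_direct Uu) (negPf neq_ki) scaler0.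
Qed.

Lemma transition_mapE (i : 'I_d.+1) v :
  v \in limg (Es i) -> transition_map E Es v = split_proj E Es i v.
Proof.
move=> Ev; rewrite /transition_map sum_lfunE (bigD1 i) //= big1 ?addr0.
  by rewrite comp_lfunE (idempotentsE stdEs i Ev) eqxx.
move=> k neq_ki.
by rewrite comp_lfunE (idempotentsE stdEs k Ev) (negPf neq_ki) linear0.
Qed.

Lemma raising_mapE (i k : 'I_d.+1) v :
    k = i.+1 :> nat -> v \in limg (Es i) ->
  raising_map A Es v = Es k (A v).
Proof.
move=> def_k Ev; have lt_id : (i < d)%N by rewrite -ltnS -def_k.
rewrite /raising_map sum_lfunE (bigD1 (Ordinal lt_id)) //= big1 ?addr0.
  rewrite !comp_lfunE (idempotentsE stdEs _ Ev) ifT; last exact/eqP/val_inj.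
  by congr (Es _ _); apply: val_inj; rewrite /= def_k.
by move=> l neq_li; rewrite !comp_lfunE (idempotentsE stdEs _ Ev) ifN ?linear0.
Qed.

End SplitDecomposition.

Theorem theorem8p9 (K : fieldType) (V : vectType K) (d : nat)
    (A As : 'End(V)) (E Es : 'I_d.+1 -> 'End(V)) (theta : 'I_d.+1 -> K)
    (V_neq0 : (0 < \dim {:V})%N)
    (d_gt0 : (1 <= d)%N)
    (Phi_TD : tridiagonal_system A E As Es)
    (theta_eigen : eigenvalue_sequence A E theta)
    (j : 'I_d.+1) (lt_jd : (j < d)%N) (v : V) (Es_j_v : v \in limg (Es j)) :
  transition_map E Es (raising_map A Es v) =
  split_raising_map A E Es theta (transition_map E Es v).
Proof.
pose k : 'I_d.+1 := Ordinal (lt_jd : (j.+1 < d.+1)%N).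
have def_k : k = j.+1 :> nat by [].
have dirU := split_space_direct Phi_TD theta_eigen.
(* [split_proj E Es k] kills [lower_flag Es j.+1], so its arguments may be changed modulo that
   flag. *)
have F0 := split_proj_lower_flag Phi_TD theta_eigen (i := k) (m := j.+1).
have stdEs : standard_idempotents As A Es by have [] := Phi_TD.
have Xv : v \in lower_flag Es j.+1.
  exact: memv_sum_sup Es_j_v.
set u := split_proj E Es j v.
have Uu : u \in split_space E Es j by exact: split_proj_mem.
rewrite (raising_mapE Phi_TD def_k Es_j_v).
rewrite (transition_mapE Phi_TD (memv_img _ (memvf (A v)))).
rewrite (transition_mapE Phi_TD Es_j_v) (split_raising_mapE Phi_TD _ Uu) //.
(* [A v] is in the flag at [j.+2]; removing its [Es k] part leaves a vector of the flag at
   [j.+1]. *)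
have FkA : split_proj E Es k (Es k (A v)) = split_proj E Es k (A v).
  apply/eqP; rewrite eq_sym -subr_eq0 -linearB /= F0 //.
  have /(idempotents_sum_sub stdEs k) := A_lower_flag Phi_TD Xv.
  apply: (subvP (sumv_widen _ _)) => l /andP[lt_l neq_lk].
  by rewrite unfold_in ltn_neqAle -def_k -ltnS lt_l andbT.
(* [v - u] is in the flag at [j], and [A] raises that index by one. *)
have FkAu : split_proj E Es k (A v) = split_proj E Es k (A u).
  apply/eqP; rewrite -subr_eq0 -!linearB /= F0 //.
  apply: (A_lower_flag Phi_TD).
  exact: (sub_split_proj_lower_flag Phi_TD theta_eigen).
have Fku : split_proj E Es k u = 0.
  by rewrite (split_projE _ dirU Uu) ifN // -val_eqE gtn_eqF.
(* The vector [A u - theta j *: u] is already in the split space of index [k], hence is fixed by the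
   projection. *)
have := split_projE k dirU (split_space_raise Phi_TD theta_eigen def_k Uu).
by rewrite FkA FkAu eqxx linearB linearZ /= Fku scaler0 subr0.
Qed.
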